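(* Let $\mathcal{SF}$ be the set of all space-filling curves $I\to\mathbb{R}^2$. Then $\mathcal{SF}$ is spaceable in $C(I,\mathbb{R}^2)$. In particular, $\mathcal{SF}$ is maximal lineable in $C(I,\mathbb{R}^2)$.
   Context: $I=[0,1]$. $C(I,\mathbb{R}^2)$ is the real vector space of continuous functions $I\to\mathbb{R}^2$, a Banach space under the norm $\|f\|=\sup_{t\in I}\|f(t)\|$, where $\|(x,y)\|=\max\{|x|,|y|\}$ on $\mathbb{R}^2$. A space-filling curve is a continuous function $\varphi:I\to\mathbb{R}^2$ such that $\varphi(I)$ is Jordan measurable and has positive Jordan content. (A bounded set $S\subset\mathbb{R}^2$ is Jordan measurable if its characteristic function is Riemann integrable, equivalently if its boundary $\partial S$ has Lebesgue measure $0$; its Jordan content is then the Riemann integral of its characteristic function.) A subset $A$ of a topological vector space $X$ is spaceable in $X$ if there is a closed infinite dimensional vector subspace $M$ of $X$ with $M\setminus\{0\}\subset A$. A subset $A$ of a vector space $X$ is maximal lineable in $X$ if there is a vector subspace $M$ of $X$ with $\dim(M)=\dim(X)$ (as cardinal numbers, algebraic dimension) and $M\setminus\{0\}\subset A$. *)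

(* Defs.v *)
From HB Require Import structures.
From mathcomp Require Import all_boot all_order all_algebra.
From mathcomp Require Import all_classical all_reals all_analysis.

Set Implicit Arguments.
Unset Strict Implicit.
Unset Printing Implicit Defensive.

Import Order.TTheory GRing.Theory Num.Theory.
Import numFieldNormedType.Exports.

Local Open Scope classical_set_scope.
Local Open Scope ring_scope.

Section riemann_integral_in_the_plane.
Context {R : realType}.
Implicit Types (a b c d : R) (s t : seq R) (f : R * R -> R).

(* An [itv_partition a b s] has the division points [a :: s], with [last a s]
   equal to [b]. *)
Definition division_point a s (i : nat) : R := nth a (a :: s) i.

Definition division_itv a s (i : nat) : set R :=
  `[division_point a s i, division_point a s i.+1].

Definition darboux_sum (bnd : set R -> R) a c s t f : R :=
  \sum_(i < size s) \sum_(j < size t)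
    bnd (f @` (division_itv a s i `*` division_itv c t j)) *
    (division_point a s i.+1 - division_point a s i) *
    (division_point c t j.+1 - division_point c t j).

Definition darboux_sums (bnd : set R -> R) a b c d f : set R :=
  [set v | exists s t,
    [/\ itv_partition a b s, itv_partition c d t &
        v = darboux_sum bnd a c s t f]].

Definition lower_integral a b c d f : R := sup (darboux_sums inf a b c d f).

Definition upper_integral a b c d f : R := inf (darboux_sums sup a b c d f).

Definition riemann_integrable a b c d f : Prop :=
  bounded_set (f @` (`[a, b] `*` `[c, d])) /\
  lower_integral a b c d f = upper_integral a b c d f.

(* Meaningful only when [riemann_integrable a b c d f]. *)
Definition riemann_integral a b c d f : R := lower_integral a b c d f.

End riemann_integral_in_the_plane.

Section jordan_content.
Context {R : realType}.
Implicit Types (S : set (R * R)).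

Definition enclosing_rectangle S (a b c d : R) : Prop :=
  [/\ a < b, c < d & S `<=` `[a, b] `*` `[c, d]].

Definition jordan_measurable S : Prop := exists a b c d : R,
  enclosing_rectangle S a b c d /\ riemann_integrable a b c d \1_S.

(* Neither the integrability nor the integral of [\1_S] depends on the
   enclosing rectangle, so that there is at most one value to choose. *)
Definition jordan_content S : R :=
  xget 0 [set v | exists a b c d : R,
    [/\ enclosing_rectangle S a b c d,
        riemann_integrable a b c d \1_S &
        v = riemann_integral a b c d \1_S]].

End jordan_content.

Section hamel_dimension.
Context {K : fieldType} {X : lmodType K}.
Implicit Types (M B : set X).

Definition lin_comb (s : seq X) (a : X -> K) : X := \sum_(x <- s) a x *: x.

Definition lin_span B : set X :=
  [set x | exists s a, [set` s] `<=` B /\ x = lin_comb s a].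

Definition lin_indep B : Prop := forall (s : seq X) (a : X -> K),
  uniq s -> [set` s] `<=` B -> lin_comb s a = 0 -> {in s, forall x, a x = 0}.

Definition hamel_basis M B : Prop :=
  [/\ B `<=` M, lin_indep B & M `<=` lin_span B].

Definition vector_subspace M : Prop := GRing.submod_closed [in M].

Definition finite_dimensional M : Prop :=
  exists2 B, hamel_basis M B & finite_set B.

Definition same_dimension M N : Prop :=
  exists BM BN, [/\ hamel_basis M BM, hamel_basis N BN & (BM #= BN)%card].

Definition maximal_lineable (A : set X) : Prop := exists M : set X,
  [/\ vector_subspace M, same_dimension M setT & M `\ 0 `<=` A].

End hamel_dimension.

Definition spaceable {K : numFieldType} {X : topologicalLmodType K}
    (A : set X) : Prop := exists M : set X,
  [/\ vector_subspace M, closed M, ~ finite_dimensional M & M `\ 0 `<=` A].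

Definition unit_itv (R : realType) : set R := `[0, 1].
Arguments unit_itv : clear implicits.

Definition curve (R : realType) : Type :=
  continuousType (unit_itv R) (R * R)%type.

Section curve_normed_module.
Context {R : realType}.
Implicit Types (f g : curve R) (k : R).

HB.instance Definition _ := Choice.on (curve R).

Let cts0 : continuous (fun _ : unit_itv R => 0 : R * R).
Proof. exact: cst_continuous. Qed.

Let ctsN f : continuous (fun t => - f t).
Proof. by move=> t; have := cvgN (@cts_fun _ _ f t); apply. Qed.

Let ctsD f g : continuous (fun t => f t + g t).
Proof. by move=> t; have := cvgD (@cts_fun _ _ f t) (@cts_fun _ _ g t); apply. Qed.

Let ctsZ k f : continuous (fun t => k *: f t).
Proof. by move=> t; have := cvgZl_tmp (k := k) (@cts_fun _ _ f t); apply. Qed.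

Definition curve0 : curve R := mkcts cts0.
Definition curve_opp f : curve R := mkcts (ctsN (f := f)).
Definition curve_add f g : curve R := mkcts (ctsD (f := f) (g := g)).
Definition curve_scale k f : curve R := mkcts (ctsZ (k := k) (f := f)).

Let curve_addA : associative curve_add.
Proof. by move=> f g h; apply/continuousEP => t; exact: addrA. Qed.

Let curve_addC : commutative curve_add.
Proof. by move=> f g; apply/continuousEP => t; exact: addrC. Qed.

Let curve_add0 : left_id curve0 curve_add.
Proof. by move=> f; apply/continuousEP => t; exact: add0r. Qed.

Let curve_addN : left_inverse curve0 curve_opp curve_add.
Proof. by move=> f; apply/continuousEP => t; exact: addNr. Qed.

HB.instance Definition _ := GRing.isZmodule.Build (curve R)
  curve_addA curve_addC curve_add0 curve_addN.

Let curve_scaleA k l f :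
  curve_scale k (curve_scale l f) = curve_scale (k * l) f.
Proof. by apply/continuousEP => t; exact: scalerA. Qed.

Let curve_scale1 : left_id 1 curve_scale.
Proof. by move=> f; apply/continuousEP => t; exact: scale1r. Qed.

Let curve_scaleDr : right_distributive curve_scale +%R.
Proof. by move=> k f g; apply/continuousEP => t; exact: scalerDr. Qed.

Let curve_scaleDl f : {morph curve_scale^~ f : k l / k + l}.
Proof. by move=> k l; apply/continuousEP => t; exact: scalerDl. Qed.

HB.instance Definition _ := GRing.Zmodule_isLmodule.Build R (curve R)
  curve_scaleA curve_scale1 curve_scaleDr curve_scaleDl.

(* [R * R] carries the maximum norm. *)
Definition curve_norm f : R := sup (range (fun t => `|f t|)).

Let curve_norm_has_sup f : has_sup (range (fun t => `|f t|)).
Proof.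
split.
  have I0 : (0 : R) \in unit_itv R by rewrite inE /unit_itv /= in_itv /= lexx ler01.
  by exists `|f (exist _ 0 I0)|, (exist _ 0 I0).
have cptf : compact (valL_ 0 f @` unit_itv R).
  apply: continuous_compact; last exact: segment_compact.
  by apply/subspace_valL_continuousP'; exact: cts_fun.
have [M [_ /(_ (M + 1)) ltM]] := compact_bounded cptf.
exists (M + 1) => _ [t _ <-].
have {}ltM : forall y, (valL_ 0 f @` unit_itv R) y -> `|y| <= M + 1.
  by move=> y; apply: ltM; rewrite ltrDl.
apply: ltM; exists (set_val t); first exact: set_valP.
have /(congr1 (@^~ t)) := @valLK _ _ (0 : R * R) (unit_itv R) f; apply.
Qed.

Let curve_norm_ub f t : `|f t| <= curve_norm f.
Proof. by apply: ub_le_sup; [case: (curve_norm_has_sup f)|exists t]. Qed.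

Let curve_norm_le f (e : R) : (forall t, `|f t| <= e) -> curve_norm f <= e.
Proof.
move=> fe; apply: ge_sup; first by case: (curve_norm_has_sup f).
by move=> _ [t _ <-].
Qed.

Let curve_normD f g : curve_norm (f + g) <= curve_norm f + curve_norm g.
Proof.
apply: curve_norm_le => t.
by apply: (le_trans (ler_normD (f t) (g t))); apply: lerD; exact: curve_norm_ub.
Qed.

Let curve_normZ k f : curve_norm (k *: f) = `|k| * curve_norm f.
Proof.
have le k' h : curve_norm (k' *: h) <= `|k'| * curve_norm h.
  apply: curve_norm_le => t; rewrite [leLHS](normrZ k' (h t)).
  by rewrite ler_wpM2l.
apply/eqP; rewrite eq_le le /=.
have [->|k0] := eqVneq k 0.
  rewrite normr0 mul0r scale0r.
  by have [[_ [t _ _]] _] := curve_norm_has_sup 0;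
     exact: le_trans (curve_norm_ub _ t).
rewrite -ler_pdivlMl ?normr_gt0// -normfV.
by rewrite -[in leLHS](scalerK k0 f) le.
Qed.

Let curve_norm_eq0 f : curve_norm f = 0 -> f = 0.
Proof.
move=> f0; apply/continuousEP => t; apply/eqP; rewrite -normr_le0 -f0.
exact: curve_norm_ub.
Qed.

HB.instance Definition _ := Lmodule_isNormed.Build R (curve R)
  curve_normD curve_normZ curve_norm_eq0.

End curve_normed_module.

Definition space_filling_curves (R : realType) : set (curve R) :=
  [set f | jordan_measurable (range f) /\ 0 < jordan_content (range f)].
Arguments space_filling_curves : clear implicits.

(* Main.v *)
Require Import Defs.
From mathcomp Require Import all_boot all_order all_algebra.
From mathcomp Require Import all_classical all_reals all_analysis.
From mathcomp Require Import ring lra.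

(** A Schoenberg curve gives a continuous surjection of [0, 1] onto the square
    [-1, 1]^2 vanishing at both end points. Paste a multiple a_n of it into each
    interval [2^-(n+1), 2^-n]: the range of the resulting curve is a union of
    concentric squares, and it is the largest one since the norm is attained. So
    a nonzero curve of this form is space-filling. Being prescribed by pointwise
    linear equations, these curves form a closed subspace.

    For the maximal dimension, an almost disjoint family of continuum many sets
    of indices n yields linearly independent curves in that subspace, and there
    are no more than continuum many curves, so a Hamel basis of the subspace and
    one of the whole space extending it are equipotent. *)

Set Implicit Arguments.
Unset Strict Implicit.
Unset Printing Implicit Defensive.

Import Order.TTheory GRing.Theory Num.Theory.
Import numFieldNormedType.Exports.

Local Open Scope classical_set_scope.
Local Open Scope ring_scope.

(** * Binary series *)

Section binary_series.
Context {R : realType}.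
Implicit Types (u x : nat -> R).

Definition binary_sum u : R := limn (series (fun k => u k / 2 ^+ k.+1)).

Lemma is_cvg_binary_sum u : (forall k, `|u k| <= 1) ->
  cvgn (series (fun k => u k / 2 ^+ k.+1)).
Proof.
move=> u1; apply: normed_cvg.
have : cvgn (series (geometric (2^-1 : R) 2^-1)).
  by apply/cvg_ex; eexists; apply: cvg_geometric_series; rewrite ger0_norm; lra.
apply: series_le_cvg => k.
- exact: normr_ge0.
- by rewrite /geometric /= mulr_ge0 ?exprn_ge0// invr_ge0.
- rewrite /geometric /= -exprS exprVn normrM (ger0_norm (x := (2 ^+ k.+1)^-1)).
    by rewrite ler_piMl// invr_ge0 exprn_ge0.
  by rewrite invr_ge0 exprn_ge0.
Qed.

(** Splitting off the first digit halves the series of the remaining ones. *)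
Lemma binary_sum_rec u : (forall k, `|u k| <= 1) ->
  binary_sum u = (u 0 + binary_sum (fun k => u k.+1)) / 2.
Proof.
move=> u1; rewrite /binary_sum.
have c := is_cvg_binary_sum (u := fun k => u k.+1) (fun k => u1 k.+1).
apply/cvg_lim => //; rewrite -(cvg_shiftn 1%N).
rewrite (_ : (fun n => _) = fun n : nat =>
    (u 0 + series (fun k => u k.+1 / 2 ^+ k.+1) n) / 2); last first.
  apply/funext => n; rewrite addn1 /series/= big_nat_recl//= expr1 mulrDl.
  congr (_ + _); rewrite mulr_suml; apply: eq_bigr => i _.
  by rewrite [in LHS]exprS invfM; ring.
by apply: cvgMl; apply: cvgD; [exact: cvg_cst|exact: c].
Qed.

Lemma ge0_binary_sum u : (forall k, 0 <= u k <= 1) -> 0 <= binary_sum u.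
Proof.
move=> u01; apply: limr_ge.
  by apply: is_cvg_binary_sum => k; have /andP[? ?] := u01 k; rewrite ger0_norm.
apply: nearW => n; rewrite /series/=; apply: sumr_ge0 => k _.
by have /andP[? ?] := u01 k; rewrite divr_ge0// exprn_ge0.
Qed.

Lemma norm_binary_sum u : (forall k, `|u k| <= 1) -> `|binary_sum u| <= 1.
Proof.
move=> u1.
(* The bound is sharpened by [2^-1 ^+ n] so that the induction closes. *)
have part n : `|series (fun k => u k / 2 ^+ k.+1) n| <= 1 - 2^-1 ^+ n.
  elim: n => [|n IH]; first by rewrite /series/= big_geq// normr0 expr0 subrr.
  rewrite seriesSr; apply: (le_trans (ler_normD _ _)).
  rewrite normrM normfV (ger0_norm (exprn_ge0 n.+1 (ler0n R 2))).
  have h : 0 <= (2^-1 : R) ^+ n by rewrite exprn_ge0.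
  rewrite -exprVn exprS.
  have := ler_wpM2r h (u1 n); lra.
have {}part n : `|series (fun k => u k / 2 ^+ k.+1) n| <= 1.
  by rewrite (le_trans (part n))// gerBl exprn_ge0// invr_ge0.
rewrite ler_norml; apply/andP; split.
  apply: limr_ge; first exact: is_cvg_binary_sum.
  by apply: nearW => n; have := part n; rewrite ler_norml => /andP[].
apply: limr_le; first exact: is_cvg_binary_sum.
by apply: nearW => n; have := part n; rewrite ler_norml => /andP[].
Qed.

Lemma cvg_half_pow : (fun n => (2^-1 : R) ^+ n) @ \oo --> 0.
Proof. by apply: cvg_expr; rewrite ger0_norm; lra. Qed.

(** Unrolling the recurrence [n] times leaves exactly [x n * 2^-1 ^+ n] as remainder. *)
Lemma binary_remainder x u : (forall k, `|x k| <= 1) ->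
  (forall k, x k = (u k + x k.+1) / 2) ->
  forall n, `|x 0 - series (fun k => u k / 2 ^+ k.+1) n| <= 2^-1 ^+ n.
Proof.
move=> x1 xE n.
have -> : x 0 - series (fun k => u k / 2 ^+ k.+1) n = x n * 2^-1 ^+ n.
  elim: n => [|n IH]; first by rewrite /series/= big_geq// subr0 expr0 mulr1.
  rewrite seriesSr opprD addrA IH (xE n) -exprVn exprS; lra.
by rewrite normrM (ger0_norm (exprn_ge0 _ _))// ler_piMl// exprn_ge0.
Qed.

(** The device for evaluating a binary series: it suffices to guess its tails [x k], since the
    remainder then tends to 0. *)
Lemma binary_sum_uniq x u : (forall k, `|x k| <= 1) ->
  (forall k, x k = (u k + x k.+1) / 2) -> binary_sum u = x 0.
Proof.
move=> x1 xE; apply/cvg_lim => //; apply/cvgrPdist_le => e e0.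
near=> n; apply: (le_trans (binary_remainder x1 xE n)).
near: n; move/cvgrPdist_le : cvg_half_pow => /(_ e e0).
by apply: filterS => n; rewrite sub0r normrN ger0_norm// exprn_ge0.
Unshelve. all: by end_near. Qed.

Lemma binary_sum_single u n : `|u n| <= 1 ->
  (forall k, k != n -> u k = 0) -> binary_sum u = u n / 2 ^+ n.+1.
Proof.
(* [x k] is the tail from index [k] on, rescaled by [2 ^+ k]. *)
move=> u1 u0; pose x k := if (k <= n)%N then u n / 2 ^+ (n - k).+1 else 0 : R.
have -> : u n / 2 ^+ n.+1 = x 0 by rewrite /x leq0n subn0.
apply: binary_sum_uniq => k.
  rewrite /x; case: ifP => _; last by rewrite normr0.
  rewrite normrM normfV (ger0_norm (exprn_ge0 _ (ler0n R 2))).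
  rewrite ler_pdivrMr ?exprn_gt0// mul1r (le_trans u1)//.
  by rewrite exprn_ege1// ler1n.
rewrite /x; have [kn|nk|->] := ltngtP k n.
- rewrite (u0 k) ?ltn_eqF// add0r (_ : (n - k).+1 = (n - k.+1).+2); last by rewrite -subnSK.
  by rewrite (exprS _ (n - k.+1).+1) invfM mulrCA mulrC.
- by rewrite (u0 k) ?gtn_eqF// add0r mul0r.
- by rewrite subnn expr1 addr0.
Qed.

(** The remainder bound does not depend on [t], so the sum is a uniform limit of continuous partial
    sums. *)
Lemma continuous_binary_sum (T : topologicalType) (u : nat -> T -> R) :
  (forall k, continuous (u k)) -> (forall k t, `|u k t| <= 1) ->
  continuous (fun t => binary_sum (u ^~ t)).
Proof.
move=> cu u1 t0.
pose s n t := series (fun k => u k t / 2 ^+ k.+1) n.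
have rem n t : `|binary_sum (u ^~ t) - s n t| <= 2^-1 ^+ n.
  apply: (binary_remainder (x := fun k => binary_sum (fun j => u (k + j)%N t))).
    by move=> k; apply: norm_binary_sum.
  move=> k; rewrite binary_sum_rec// addn0; congr ((_ + binary_sum _) / 2).
  by apply/funext => j; rewrite addnS.
have cs n : continuous (s n).
  rewrite /s; elim: n => [|n IH] t.
    rewrite (_ : (fun _ => _) = fun=> 0); first exact: cst_continuous.
    by apply/funext => y; rewrite /series/= big_geq.
  rewrite (_ : (fun _ => _) =
    (fun y => series (fun k => u k y / 2 ^+ k.+1) n + u n y / 2 ^+ n.+1)).
    by apply: cvgD; [exact: IH|apply: cvgMl; exact: cu].
  by apply/funext => y; rewrite seriesSr.
apply/cvgrPdist_le => e e0.
have e3 : 0 < e / 3 by rewrite divr_gt0.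
have [n ne] : exists n, (2^-1 : R) ^+ n <= e / 3.
  have [n _ /(_ n (leqnn n)) ne] : \forall n \near \oo, (2^-1 : R) ^+ n <= e / 3.
    move/cvgrPdist_le : cvg_half_pow => /(_ _ e3); apply: filterS => n.
    by rewrite sub0r normrN ger0_norm// exprn_ge0.
  by exists n.
have /cvgrPdist_le/(_ _ e3) := cs n t0.
apply: filterS => t st.
have -> : binary_sum (u ^~ t0) - binary_sum (u ^~ t) =
  (binary_sum (u ^~ t0) - s n t0) + (s n t0 - s n t) -
  (binary_sum (u ^~ t) - s n t) by ring.
apply: (le_trans (ler_normB _ _)); apply: (le_trans (lerD (ler_normD _ _) (lexx _))).
have := rem n t; have := rem n t0; lra.
Qed.

End binary_series.

(** * A space-filling curve *)

Section square_filling.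
Context {R : realType}.
Implicit Types (t x y : R).

Definition clamp (a b t : R) : R := Num.max a (Num.min b t).

Lemma clamp_itv a b t : a <= b -> a <= clamp a b t <= b.
Proof. by move=> ab; rewrite /clamp le_max lexx ge_max ab ge_min lexx. Qed.

Lemma clamp_id a b t : a <= t <= b -> clamp a b t = t.
Proof. by move=> /andP[at_ tb]; rewrite /clamp (min_idPr tb) (max_idPr at_). Qed.

Lemma continuous_clamp a b (T : topologicalType) (f : T -> R) :
  continuous f -> continuous (fun z => clamp a b (f z)).
Proof.
move=> cf z; apply: (@continuous_max R T (fun=> a) (fun z => Num.min b (f z))).
  exact: cst_continuous.
by apply: (@continuous_min R T (fun=> b)); [exact: cst_continuous|exact: cf].
Qed.

Lemma clampN a t : 0 <= a -> clamp (- a) a (- t) = - clamp (- a) a t.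
Proof.
move=> a0; rewrite /clamp !maxEle !minEle.
case: (leP a (- t)); case: (leP a t) => ? ?; do 2?[case: leP => ?]; lra.
Qed.

(** A variant of Schoenberg's periodic function: period 1, odd under a shift by 1/2, and constant on
    a plateau, here obtained by truncating a cosine. *)
Definition wave t : R := clamp (-1) 1 (2 * cos (t * (pi *+ 2))).

Lemma norm_wave t : `|wave t| <= 1.
Proof. by rewrite ler_norml; apply: clamp_itv; lra. Qed.

Lemma continuous_wave : continuous wave.
Proof.
apply: continuous_clamp => t; apply: cvgMr.
apply: (continuous_comp (f := fun t => t * (pi *+ 2))).
  by apply: cvgMl; exact: cvg_id.
exact: continuous_cos.
Qed.

Lemma wave_period t n : wave (t + n%:R) = wave t.
Proof.
by rewrite /wave (mulrDl t) (mulr_natl _ n) (periodicn (@cosD2pi R)).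
Qed.

Lemma wave_half t : wave (t + 1 / 2) = - wave t.
Proof.
rewrite /wave (mulrDl t) (_ : 1 / 2 * (pi *+ 2) = pi); last by rewrite -[pi *+ 2]mulr_natl; lra.
by rewrite cosDpi mulrN clampN.
Qed.

Lemma wave_eq1 t : 0 <= t <= 1 / 8 -> wave t = 1.
Proof.
move=> t8; suff c2 : 1 / 2 <= cos (t * (pi *+ 2)).
  by rewrite /wave /clamp (min_idPl _) ?(max_idPr _)//; lra.
have p0 := @pi_gt0 R.
set s := t * (pi *+ 2).
have s0 : 0 <= s by apply: mulr_ge0; [case/andP: t8|rewrite mulrn_wge0 ?ltW].
have s1 : s <= pi / 4.
  rewrite /s -[pi *+ 2]mulr_natl mulrA mulrC ler_wpM2l ?(ltW p0)//.
  by move: t8; lra.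
(* The double angle is at most [pi / 2], so [2 * cos s ^+ 2 - 1] is nonnegative; this gives the
   bound 1/2 on [cos s]. *)
have c0 : 0 <= cos (s *+ 2).
  by apply: cos_ge0_pihalf; rewrite -[s *+ 2]mulr_natl; lra.
have c1 : 0 <= cos s by apply: cos_ge0_pihalf; lra.
by move: c0; rewrite cos_mulr2n -mulr_natl; nra.
Qed.

(* Base 8 expansion with digits 0 and 4, the bits of which are the binary
   digits at the positions divisible by 3. *)
Lemma wave_code (b : nat -> bool) :
  exists2 t, 0 <= t <= 1 & forall k : nat, wave (8 ^+ k * t) = (-1) ^+ b k.
Proof.
pose u (k j : nat) : R := if (3 %| j)%N then (b (k + j %/ 3)%N)%:R else 0.
pose r k := binary_sum (u k).
have u01 k j : 0 <= u k j <= 1.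
  by rewrite /u; case: ifP => _; [case: (b _)|]; rewrite ?lexx ?ler01.
have u1 k j : `|u k j| <= 1 by have /andP[? ?] := u01 k j; rewrite ger0_norm.
have r01 k : 0 <= r k <= 1.
  rewrite ge0_binary_sum//=.
  by have := norm_binary_sum (u1 k); rewrite ler_norml => /andP[].
have rE k : r k = (b k)%:R / 2 + r k.+1 / 8.
  rewrite /r binary_sum_rec// binary_sum_rec// binary_sum_rec//.
  rewrite {1 2 3}/u /= addn0.
  rewrite (_ : (fun j => u k j.+3) = u k.+1); first by lra.
  apply/funext => j; rewrite /u -(addn3 j) dvdn_addl// divnDr// divnn/=.
  by rewrite addn1 addnS addSn.
(* Multiplication by 8 shifts the expansion by one digit, up to an integer that the period of [wave]
   absorbs. *)
have waver k j : wave (8 ^+ k * r j) = wave (r (j + k)%N).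
  elim: k j => [|k IH] j; first by rewrite mul1r addn0.
  rewrite addnS -addSn -IH rE.
  rewrite (_ : 8 ^+ k.+1 * _ = 8 ^+ k * r j.+1 + (8 ^ k * 4 * b j)%:R).
    exact: wave_period.
  by rewrite !natrM natrX exprS; lra.
exists (r 0%N) => // k; rewrite waver add0n rE.
(* The argument lies in [0, 1/8] or in [1/2, 5/8] according to the bit [b k]: a plateau of value 1
   or of value -1. *)
have /andP[r0 r1] := r01 k.+1.
case: (b k) => /=; last by rewrite mul0r add0r wave_eq1//; lra.
by rewrite addrC wave_half wave_eq1//; lra.
Qed.

Lemma sign_expansion x : `|x| <= 1 ->
  (* The proof expands greedily: each digit is the sign of the current remainder [y], and doubling
     [y] and subtracting the digit stays within [-1, 1]. *)
  exists b : nat -> bool, binary_sum (fun k => (-1) ^+ b k) = x.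
Proof.
move=> x1; pose xs k := iter k (fun y => 2 * y - (-1) ^+ (y < 0)%R) x.
exists (fun k => (xs k < 0)%R); apply: (binary_sum_uniq (x := xs)) => k.
  elim: k => //= k; rewrite !ler_norml; case: ltP => /=; lra.
rewrite /=; lra.
Qed.

Definition bump t : R := clamp 0 1 (Num.min (3 * t) (3 - 3 * t)).

(** Schoenberg's two coordinates, reading the even ([i = false]) or odd digits of a base 8 code. The
    code [3 * t - 1] runs through [0, 1] while [bump] is 1, on the middle third; the outer thirds
    serve to descend to 0. *)
Definition square_coord (i : bool) t : R :=
  bump t * binary_sum (fun k => wave (8 ^+ (i + k.*2) * (3 * t - 1))).

Lemma square_coord_out i t : ~~ (0 < t < 1) -> square_coord i t = 0.
Proof.
move=> t01; rewrite /square_coord (_ : bump t = 0) ?mul0r// /bump /clamp.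
apply/max_idPl; rewrite ge_min; apply/orP; right; rewrite ge_min.
by move: t01; rewrite negb_and -!leNgt => /orP[] ?; apply/orP; [left|right]; lra.
Qed.

Lemma norm_square_coord i t : `|square_coord i t| <= 1.
Proof.
rewrite normrM; apply: mulr_ile1 => //; last first.
  by apply: norm_binary_sum => k; exact: norm_wave.
have /andP[b0 b1] := clamp_itv (Num.min (3 * t) (3 - 3 * t)) (@ler01 R).
by rewrite ger0_norm.
Qed.

Lemma continuous_square_coord i : continuous (square_coord i).
Proof.
have affine (a b : R) : continuous (fun z : R => a * z + b).
  move=> z; apply: cvgD; last exact: cvg_cst.
  by apply: cvgMr; exact: cvg_id.
move=> t; apply: (@cvgM _ _ _ _ bump); rewrite -/(continuous_at _ _).
  apply: continuous_clamp => {}t.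
  apply: (@continuous_min R R (fun z => 3 * z) (fun z => 3 - 3 * z)).
    by apply: cvgMr; exact: cvg_id.
  by have := affine (-3) 3 t; under eq_fun do rewrite mulNr addrC.
apply: (@continuous_binary_sum _ R (fun k z => wave (8 ^+ (i + k.*2) * (3 * z - 1)))).
  move=> k {}t; apply: (@continuous_comp R R R (fun z => 8 ^+ (i + k.*2) * (3 * z - 1))).
    by apply: cvgMr; exact: affine.
  exact: continuous_wave.
by move=> k s; exact: norm_wave.
Qed.

Lemma square_coord_surj x y : `|x| <= 1 -> `|y| <= 1 -> exists t,
  [/\ 0 <= t <= 1, square_coord false t = x & square_coord true t = y].
Proof.
move=> /sign_expansion[cx cxE] /sign_expansion[cy cyE].
(* The sign expansions of both coordinates are interleaved into one code. *)
have [t /andP[t0 t1] tE] := wave_code (fun j => if odd j then cy j./2 else cx j./2).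
exists ((t + 1) / 3).
have s1 : 3 * ((t + 1) / 3) - 1 = t by lra.
have b1 : bump ((t + 1) / 3) = 1.
  by rewrite /bump /clamp (min_idPl _) ?(max_idPr _)// le_min; apply/andP; split; lra.
rewrite /square_coord b1 s1 !mul1r; split; first lra.
- rewrite -cxE; congr binary_sum; apply/funext => k.
  by rewrite tE add0n odd_double doubleK.
- rewrite -cyE; congr binary_sum; apply/funext => k.
  by rewrite tE /= odd_double/= uphalf_double.
Qed.

End square_filling.

(** * Hamel bases *)

Section hamel_bases.
Context {K : fieldType} {X : lmodType K}.
Implicit Types (M B L : set X) (s : seq X).

Lemma sub_lin_span B : B `<=` lin_span B.
Proof.
move=> x Bx; exists [:: x], (fun=> 1); split; first by move=> y; rewrite /= inE => /eqP ->.
by rewrite /lin_comb big_seq1 scale1r.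
Qed.

(** A finite list meets finitely many members of the chain, and the largest one suffices. The
    alternative [set0] covers lists inside [L], in particular for the empty chain. *)
Lemma chain_union_seq (F : set (set X)) L s : total_on F subset ->
  [set` s] `<=` \bigcup_(A in F) A `|` L ->
  exists A, (F A \/ A = set0) /\ [set` s] `<=` A `|` L.
Proof.
move=> Ftot; elim: s => [_|x s IH sF]; first by exists set0; split; [right|].
have [y ys|A [FA sA]] := IH; first by apply: sF; rewrite /= in_cons ys orbT.
have xs B C : ([set` s] `<=` B `|` L) -> B `<=` C -> (C `|` L) x ->
    [set` x :: s] `<=` C `|` L.
  move=> sB BC Cx y /=; rewrite in_cons => /orP[/eqP -> //|/sB[/BC|]]; by [left|right].
have [|[B FB Bx]|Lx] := sF x; first exact: mem_head; last first.
  by exists A; split => //; apply: (xs A A) => //; right.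
have [AB|BA] : A `<=` B \/ B `<=` A.
  by case: FA => [FA|->]; [exact: Ftot|left].
- by exists B; split; [left|apply: (xs A B) => //; left].
- by exists A; split => //; apply: (xs A A) => //; left; exact: BA.
Qed.

Lemma hamel_basis_extension M L : vector_subspace M -> L `<=` M -> lin_indep L ->
  exists2 B, L `<=` B & hamel_basis M B.
Proof.
move=> Msub LM Li.
(* Adjoining [L] to [A], instead of requiring [A] to contain it, makes the union of the empty chain
   admissible for Zorn's lemma. *)
pose P (A : set X) := A `|` L `<=` M /\ lin_indep (A `|` L).
have [F FP Ftot|A [[AM Ai] Amax]] := @Zorn_bigcup X P.
  split; first by move=> x [[A FA Ax]|/LM//]; apply: (FP A FA).1; left.
  move=> s a us /(chain_union_seq Ftot)[A [FA sA]].
  by case: FA sA => [/FP[_]|->]; [exact|rewrite set0U; exact: Li].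
exists (A `|` L); first by right.
split => // x Mx; apply: contrapT => xspan.
apply: (Amax (A `|` [set x])).
  split; first by left.
  move=> /(_ x (or_intror erefl)) Ax; apply: xspan; apply: sub_lin_span; by left.
split.
  by move=> y [[Ay|->//]|Ly]; apply: AM; [left|right].
move=> s a us sAx s0.
have sAL y : y \in s -> y != x -> (A `|` L) y.
  move=> ys yx; have [[Ay|yx']|Ly] := sAx _ ys; [by left| |by right].
  by rewrite yx' eqxx in yx.
(* Otherwise dividing by [a x] would put [x] in the span. *)
have ax0 : x \in s -> a x = 0.
  move=> xs; apply: contrapT => /eqP ax; apply: xspan.
  exists (rem x s), (fun y => - (a x)^-1 * a y); split.
    by move=> y /=; rewrite mem_rem_uniq// inE => /andP[yx ys]; exact: sAL.
  move: s0; rewrite /lin_comb (perm_big _ (perm_to_rem xs)) big_cons => s0.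
  rewrite (_ : \sum_(_ <- _) _ = - (a x)^-1 *: \sum_(y <- rem x s) a y *: y).
    move/eqP : s0; rewrite addr_eq0 -eqr_oppLR => /eqP <-.
    by rewrite scalerN scaleNr opprK scalerA mulVf// scale1r.
  by rewrite scaler_sumr; apply: eq_bigr => y _; rewrite scalerA.
move=> y ys; have [yx|yx] := eqVneq y x; first by rewrite yx ax0// -yx.
apply: (Ai [seq z <- s | z != x] a) => //; first exact: filter_uniq.
- by move=> z /=; rewrite mem_filter => /andP[zx zs]; exact: sAL.
- rewrite -[RHS]s0 /lin_comb big_filter.
  rewrite [RHS](bigID (fun z => z != x))/= [X in _ + X]big1_seq ?addr0//.
  by move=> z; rewrite negbK => /andP[/eqP -> xs]; rewrite ax0// scale0r.
- by rewrite mem_filter yx.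
Qed.

Definition linear_functional (c : X -> K) :=
  forall k x y, c (k *: x + y) = k * c x + c y.

Lemma functional_lin_comb c s (a : X -> K) : linear_functional c ->
  c (lin_comb s a) = \sum_(x <- s) a x * c x.
Proof.
move=> clin; rewrite /lin_comb; elim: s => [|x s IH]; last by rewrite !big_cons clin IH.
by rewrite !big_nil; have := clin (-1) 0 0; rewrite scaler0 addr0 mulN1r addNr.
Qed.

(** A rank argument: with a finite basis, the identity matrix of one size more would have its rows
    spanned by the values of the functionals on the basis. *)
Lemma infinite_dimensional M (c : nat -> X -> K) (f : nat -> X) :
  (forall i, linear_functional (c i)) -> (forall j, M (f j)) ->
  (forall i j, c i (f j) = (i == j)%:R) -> ~ finite_dimensional M.
Proof.
move=> clin fM cf [B [BM Bi Bspan] /finite_seqP[e BE]].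
pose A := \matrix_(k < size e, i < (size e).+1) c i e`_k.
suff : (1%:M <= A)%MS.
  by move=> /mxrankS; rewrite mxrank1 => /leq_trans/(_ (rank_leq_row _)); rewrite ltnn.
apply/row_subP => j; have [s [a [sB fE]]] := Bspan _ (fM j).
have -> : row j 1%:M = \sum_(x <- s) a x *: \row_(i < (size e).+1) c i x.
  apply/rowP => i; rewrite summxE !mxE -val_eqE /= eq_sym -cf fE functional_lin_comb//.
  by apply: eq_bigr => x _; rewrite !mxE.
rewrite big_seq; apply: summx_sub => x xs; apply: scalemx_sub.
have xe : x \in e by have := sB _ xs; rewrite BE.
have ie : (index x e < size e)%N by rewrite index_mem.
rewrite (_ : \row_i _ = row (Ordinal ie) A) ?row_sub//.
by apply/rowP => i; rewrite !mxE /= nth_index.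
Qed.

(** Extending [L] to a basis [B] of [M] and [B] to a basis [C] of the whole space closes the circle
    of cardinalities [B], [C], [X], [L], [B]. *)
Lemma same_dimension_setT M L : vector_subspace M -> L `<=` M -> lin_indep L ->
  ([set: X] #<= L)%card -> same_dimension M setT.
Proof.
move=> Msub LM Li XL; have [B LB MB] := hamel_basis_extension Msub LM Li; have [_ Bi _] := MB.
have [|//|C BC XC] := @hamel_basis_extension setT B _ _ Bi.
  by split; rewrite ?inE// => k x y _ _; rewrite inE.
exists B, C; split => //; rewrite card_eq_le subset_card_le//=.
apply: (card_le_trans (card_leT C)); apply: (card_le_trans XL).
exact: subset_card_le.
Qed.

End hamel_bases.

(** * Jordan content of a square *)

Section jordan_square.
Context {R : realType}.
Implicit Types (a b c d r : R) (s t : seq R) (S : set (R * R)).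

Lemma division_point_lt a b s i : itv_partition a b s -> (i < size s)%N ->
  division_point a s i < division_point a s i.+1.
Proof. by move=> [/(pathP a) + _] => /[apply]. Qed.

Lemma sum_division a b s : itv_partition a b s ->
  \sum_(i < size s) (division_point a s i.+1 - division_point a s i) = b - a.
Proof.
move=> abs; rewrite -(big_mkord xpredT
  (fun i => division_point a s i.+1 - division_point a s i)) telescope_sumr//.
by rewrite /division_point (itv_partition_nth_size _ abs).
Qed.

Lemma division_itv_sub a b s i : itv_partition a b s -> (i < size s)%N ->
  division_itv a s i `<=` `[a, b].
Proof.
move=> abs si x; rewrite /division_itv /division_point /= !in_itv/= => /andP[lx xu].
apply/andP; split.
  apply: le_trans lx; rewrite (set_nth_default b) ?ltnS ?(ltnW si)//.
  by apply: itv_partition_nth_ge => //; rewrite ltnS ltnW.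
apply: (le_trans xu); rewrite (set_nth_default b)//.
by rewrite -[nth _ _ _]/(nth b (a :: s) i.+1); exact: itv_partition_nth_le.
Qed.

Lemma division_cell_neq0 a b c d s t i j :
  itv_partition a b s -> itv_partition c d t -> (i < size s)%N -> (j < size t)%N ->
  division_itv a s i `*` division_itv c t j !=set0.
Proof.
move=> abs cdt si tj; exists (division_point a s i, division_point c t j).
by split; rewrite /division_itv /= in_itv/= lexx ltW//;
  [exact: division_point_lt abs _|exact: division_point_lt cdt _].
Qed.

Lemma darboux_sum_const bnd a b c d s t (f : R * R -> R) v :
  itv_partition a b s -> itv_partition c d t ->
  (forall i j, (i < size s)%N -> (j < size t)%N ->
     bnd (f @` (division_itv a s i `*` division_itv c t j)) = v) ->
  darboux_sum bnd a c s t f = v * (b - a) * (d - c).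
Proof.
move=> abs cdt bndE; rewrite /darboux_sum -(sum_division abs) mulr_sumr mulr_suml.
apply: eq_bigr => i _; rewrite -(sum_division cdt) mulr_sumr.
by apply: eq_bigr => j _; rewrite bndE.
Qed.

Lemma darboux_sum_le bnd a b c d s t (f : R * R -> R) v :
  itv_partition a b s -> itv_partition c d t ->
  (forall A, bnd (f @` A) <= v) ->
  darboux_sum bnd a c s t f <= v * (b - a) * (d - c).
Proof.
move=> abs cdt bndv; rewrite /darboux_sum -(sum_division abs) mulr_sumr mulr_suml.
apply: ler_sum => i _; rewrite -(sum_division cdt) mulr_sumr.
apply: ler_sum => j _.
have si := division_point_lt abs (ltn_ord i).
have tj := division_point_lt cdt (ltn_ord j).
by rewrite !ler_wpM2r// subr_ge0 ltW.
Qed.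

Lemma inf_indic_itv S (A : set (R * R)) : 0 <= inf (\1_S @` A : set R) <= 1.
Proof.
have lb : lbound (\1_S @` A : set R) 0 by move=> _ [z _ <-]; rewrite indicE.
(* [inf] of the empty set is 0 by convention. *)
have [->|/set0P[z Az]] := eqVneq A set0; first by rewrite image_set0 inf0 lexx ler01.
apply/andP; split; first by apply: lb_le_inf => //; exists (\1_S z), z.
apply: (@le_trans _ _ (\1_S z)); last by rewrite indicE; case: (_ \in _).
by apply: ge_inf; [exists 0|exists z].
Qed.

Definition square r : set (R * R) := `[- r, r] `*` `[- r, r].

(** With the square as its own enclosing rectangle, the indicator is 1 on every cell, so all lower
    and upper sums equal the area. *)
Lemma jordan_measurable_square r : 0 < r -> jordan_measurable (square r).
Proof.
move=> r0; have rr : - r < r by lra.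
exists (- r), r, (- r), r; split; first by split.
have fE s t i j : itv_partition (- r) r s -> itv_partition (- r) r t ->
    (i < size s)%N -> (j < size t)%N ->
    \1_(square r) @` (division_itv (- r) s i `*` division_itv (- r) t j) = [set 1 : R].
  move=> rs rt si tj; apply/seteqP; split => [_ [z [z1 z2] <-]|_ ->].
    by rewrite indicE mem_set//; split; [exact: division_itv_sub z1|exact: division_itv_sub z2].
  have [z zc] := division_cell_neq0 rs rt si tj; exists z => //.
  case: zc => z1 z2.
  by rewrite indicE mem_set//; split; [exact: division_itv_sub z1|exact: division_itv_sub z2].
have sums (bnd : set R -> R) : bnd [set 1] = 1 ->
    darboux_sums bnd (- r) r (- r) r \1_(square r) = [set (r - - r) * (r - - r)].
  move=> bnd1; apply/seteqP; split => [_ [s [t [rs rt ->]]]|_ ->].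
    by rewrite (darboux_sum_const (v := 1) rs rt) ?mul1r// => i j si tj; rewrite fE.
  exists [:: r], [:: r]; have p := itv_partition1 rr; split => //.
  by rewrite (darboux_sum_const (v := 1) p p) ?mul1r// => i j si tj; rewrite fE.
split.
  exists 1; split => // M M1 _ [z _ <-].
  by rewrite indicE; case: (_ \in _) => /=; rewrite ?normr1 ?normr0 ltW// (lt_trans ltr01).
by rewrite /lower_integral /upper_integral !sums ?sup1 ?inf1.
Qed.

(** Every enclosing rectangle is treated, since the one behind the value chosen by [jordan_content]
    is unknown. *)
Lemma lower_integral_square_gt0 r a b c d : 0 < r ->
  enclosing_rectangle (square r) a b c d ->
  0 < lower_integral a b c d \1_(square r).
Proof.
move=> r0 [ab cd sub].
have [/=] : (`[a, b] `*` `[c, d]) (- r, - r).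
  by apply: sub; split; rewrite /= in_itv/= lexx; lra.
rewrite !in_itv/= => /andP[ar _] /andP[cr _].
have [/=] : (`[a, b] `*` `[c, d]) (r, r).
  by apply: sub; split; rewrite /= in_itv/= lexx andbT; lra.
rewrite !in_itv/= => /andP[_ rb] /andP[_ rd].
(* Division points at half the size stay strictly inside [a, b] even when the rectangle is tight.
   The middle cell lies in the square and has area [r * r]. *)
have pab : itv_partition a b [:: - (r / 2); r / 2; b].
  by split => //=; rewrite andbT; apply/and3P; split; lra.
have pcd : itv_partition c d [:: - (r / 2); r / 2; d].
  by split => //=; rewrite andbT; apply/and3P; split; lra.
have le_ub := darboux_sum_le (bnd := inf) (f := \1_(square r)) (v := 1).
apply: (@lt_le_trans _ _ (r * r)); first exact: mulr_gt0.
apply: (@le_trans _ _ (darboux_sum inf a c [:: - (r / 2); r / 2; b]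
    [:: - (r / 2); r / 2; d] \1_(square r))); last first.
  apply: ub_le_sup; last by exists [:: - (r / 2); r / 2; b], [:: - (r / 2); r / 2; d].
  (* The lower sums must be bounded for [sup] to dominate them. *)
  exists (1 * (b - a) * (d - c)) => _ [s [t [abs cdt ->]]]; apply: le_ub => // A.
  by have /andP[] := inf_indic_itv (square r) A.
rewrite /darboux_sum.
pose F (i j : 'I_3) := inf ((\1_(square r) : _ -> R) @`
  (division_itv a [:: - (r / 2); r / 2; b] i `*` division_itv c [:: - (r / 2); r / 2; d] j)) *
  (division_point a [:: - (r / 2); r / 2; b] i.+1 - division_point a [:: - (r / 2); r / 2; b] i) *
  (division_point c [:: - (r / 2); r / 2; d] j.+1 - division_point c [:: - (r / 2); r / 2; d] j).
have F0 i j : 0 <= F i j.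
  have si := division_point_lt pab (ltn_ord i).
  have tj := division_point_lt pcd (ltn_ord j).
  have /andP[i0 _] := inf_indic_itv (square r)
    (division_itv a [:: - (r / 2); r / 2; b] i `*` division_itv c [:: - (r / 2); r / 2; d] j).
  by rewrite !mulr_ge0// subr_ge0 ltW.
pose m : 'I_3 := inord 1.
rewrite (bigD1 m)//= (bigD1 m)//= -addrA.
apply: (@le_trans _ _ (F m m)).
  rewrite /F /m /= inordK// /division_point /=.
  rewrite (_ : _ @` _ = [set 1]).
    by rewrite inf1; lra.
  apply/seteqP; split => [_ [z [z1 z2] <-]|_ ->].
    move: z1 z2; rewrite /division_itv /division_point /= !in_itv/= => z1 z2.
    by rewrite indicE mem_set//; split; rewrite /= in_itv/=; lra.
  exists (0, 0); last by rewrite indicE mem_set//; split; rewrite /= in_itv/=; lra.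
  by split; rewrite /division_itv /division_point /= in_itv/=; lra.
rewrite lerDl; apply: addr_ge0.
  by apply: sumr_ge0 => j _; exact: F0.
by apply: sumr_ge0 => i _; apply: sumr_ge0 => j _; exact: F0.
Qed.

Lemma jordan_content_gt0 r : 0 < r -> 0 < jordan_content (square r).
Proof.
move=> r0; rewrite /jordan_content.
case: xgetP => [v -> [a [b [c [d [encl _ ->]]]]]|none].
  exact: lower_integral_square_gt0.
have [a [b [c [d [encl int]]]]] := jordan_measurable_square r0.
by exfalso; apply: (none (riemann_integral a b c d \1_(square r))); exists a, b, c, d.
Qed.

End jordan_square.

(** * Curves pasted from copies of a space-filling curve *)

Section block_curves.
Context {R : realType}.
Implicit Types (f g : curve R) (t : R) (n : nat).

(** * Curves as functions of a real parameter, and their norm *)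

Lemma mem_clamp01 t : clamp 0 1 t \in unit_itv R.
Proof. by rewrite inE /unit_itv /= in_itv/=; exact: clamp_itv. Qed.

(** A continuous retraction of the line onto the interval; it lets curves be evaluated at real
    numbers without membership proofs. *)
Definition unit_point t : unit_itv R := exist _ (clamp 0 1 t) (mem_clamp01 t).

Lemma val_unit_point t : 0 <= t <= 1 -> set_val (unit_point t) = t.
Proof. exact: clamp_id. Qed.

Lemma set_val_itv (z : unit_itv R) : 0 <= set_val z <= 1.
Proof. by have := set_valP z; rewrite /unit_itv /= in_itv. Qed.

Lemma unit_pointK (z : unit_itv R) : unit_point (set_val z) = z.
Proof. by apply: val_inj; apply: val_unit_point; exact: set_val_itv. Qed.

Lemma continuous_unit_point : continuous unit_point.
Proof.
apply: (@continuous_comp_initial _ R R set_val unit_point).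
by apply: continuous_clamp => t; exact: cvg_id.
Qed.

Lemma continuous_set_val (g : R -> R * R) : continuous g ->
  continuous (fun z : unit_itv R => g (set_val z)).
Proof.
move=> cg z; apply: (@continuous_comp (unit_itv R) R _ set_val g); last exact: cg.
exact: initial_continuous.
Qed.

Lemma continuous_curve_path f : continuous (fun t => f (unit_point t)).
Proof.
move=> t; apply: (@continuous_comp R (unit_itv R) _ unit_point f).
  exact: continuous_unit_point.
exact: cts_fun.
Qed.

Lemma curve_norm_attained f :
  exists2 z, `|f z| = `|f| & forall y, `|f y| <= `|f|.
Proof.
have [c _ cmax] : exists2 c : R, c \in `[(0:R), 1] &
    forall t, t \in `[0, 1] -> `|f (unit_point t)| <= `|f (unit_point c)|.
  apply: EVT_max => //; apply: continuous_subspaceT => t.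
  by apply: cvg_norm; exact: continuous_curve_path.
have fc y : `|f y| <= `|f (unit_point c)|.
  by rewrite -(unit_pointK y); apply: cmax; rewrite in_itv/=; exact: set_val_itv.
have normE : `|f| = `|f (unit_point c)|.
  apply/eqP; rewrite -[`|f|]/(sup (range (fun y => `|f y|))) eq_le; apply/andP; split.
    by apply: ge_sup; [exists `|f (unit_point c)|, (unit_point c)|move=> _ [y _ <-]].
  by apply: ub_le_sup; [exists `|f (unit_point c)| => _ [y _ <-]|exists (unit_point c)].
by exists (unit_point c); rewrite normE.
Qed.

Lemma curve_addE f g z : (f + g) z = f z + g z. Proof. by []. Qed.
Lemma curve_scaleE k f z : (k *: f) z = k *: f z. Proof. by []. Qed.
Lemma curve_subE f g z : (f - g) z = f z - g z. Proof. by []. Qed.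

Lemma norm_pair (p : R * R) : `|p| = Num.max `|p.1| `|p.2|.
Proof. by []. Qed.

(** * The closed subspace of block curves *)

Definition square_curve t : R * R := (square_coord false t, square_coord true t).

Lemma exists_corner : exists t, 0 <= t <= 1 /\ square_curve t = (1, 1).
Proof.
have [||t [t01 tx ty]] := @square_coord_surj R 1 1; rewrite ?normr1//.
by exists t; rewrite /square_curve tx ty.
Qed.

Definition corner_time : R := sval (cid exists_corner).

Lemma corner_timeP : 0 <= corner_time <= 1 /\ square_curve corner_time = (1, 1).
Proof. exact: svalP (cid exists_corner). Qed.

(* Maps [2^-(n+1), 2^-n] affinely onto [0, 1]. *)
Definition zoom n t : R := 2 ^+ n.+1 * t - 1.
Definition unzoom n t : R := (t + 1) / 2 ^+ n.+1.

Lemma unzoomK n t : zoom n (unzoom n t) = t.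
Proof. by rewrite /zoom /unzoom mulrC divfK ?addrK// expf_neq0. Qed.

Lemma zoom_unit n t : 0 <= zoom n t <= 1 -> 0 < t <= 1.
Proof.
rewrite /zoom => /andP[z0 z1].
have e2 : 1 <= 2 ^+ n :> R by rewrite exprn_ege1// ler1n.
by move: z0 z1; rewrite exprS; nra.
Qed.

Lemma zoom_cover t : 0 < t <= 1 -> exists n, 0 <= zoom n t <= 1.
Proof.
move=> /andP[t0 t1].
have ex : exists n, (1 <= 2 ^+ n.+1 * t).
  have [n _ /(_ n (leqnn n)) nt] : \forall n \near \oo, (2^-1 : R) ^+ n <= t.
    move/cvgrPdist_le : (@cvg_half_pow R) => /(_ _ t0); apply: filterS => n.
    by rewrite sub0r normrN ger0_norm// exprn_ge0.
  exists n; have : 1 <= 2 ^+ n * t by rewrite mulrC -ler_pdivrMr ?exprn_gt0// mul1r -exprVn.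
  by rewrite exprS; nra.
(* For the least such [n], also [2 ^+ n.+1 * t <= 2]: by minimality if [n] is positive, by [t <= 1]
   if [n] is 0. *)
have [n nt nmin] := ex_minnP ex; exists n; rewrite /zoom.
case: n nt nmin => [|n] nt nmin; first by move: nt; rewrite expr1; lra.
have [/nmin|] := leP 1 (2 ^+ n.+1 * t); first by rewrite ltnn.
by move: nt; rewrite (exprS _ n.+1); lra.
Qed.

(** The square curve passes through (1, 1) at [corner_time], so this evaluation recovers the factor
    of block [n], linearly and continuously in [f]. *)
Definition amplitude n f : R := (f (unit_point (unzoom n corner_time))).1.

Definition block_space : set (curve R) := [set f : curve R | f (unit_point 0) = 0 /\
  forall n t, 0 <= zoom n t <= 1 ->
    f (unit_point t) = amplitude n f *: square_curve (zoom n t)].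

Lemma amplitude_linear n : linear_functional (amplitude n).
Proof. by []. Qed.

Lemma block_space_subspace : vector_subspace block_space.
Proof.
split; rewrite ?inE.
  by split => // n t _; rewrite /amplitude /= scale0r.
move=> k f g; rewrite !inE => -[f0 fE] [g0 gE]; split.
  by rewrite curve_addE curve_scaleE f0 g0 scaler0 addr0.
move=> n t nt; rewrite curve_addE curve_scaleE (fE n t nt) (gE n t nt).
by rewrite amplitude_linear scalerDl scalerA.
Qed.

Lemma norm_evalB f g z : `|f z - g z| <= `|f - g|.
Proof. by rewrite -curve_subE; have [_ _] := curve_norm_attained (f - g). Qed.

Lemma norm_square_curve t : `|square_curve t| <= 1.
Proof. by rewrite norm_pair ge_max !norm_square_coord. Qed.

(** A member [g] satisfies each equation exactly, so the defect of [f] in it is at most twice the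
    distance from [f] to [g]. *)
Lemma block_space_closed : closed block_space.
Proof.
move=> f fcl.
have approx (e : R) : 0 < e -> exists2 g, block_space g & `|f - g| <= e.
  move=> e0; have [g [gM fg]] := fcl (ball f e) (nbhsx_ballx f _ e0).
  by exists g => //; move: fg; rewrite -ball_normE => /ltW.
have eq0 (p : R * R) : (forall e, 0 < e -> `|p| <= e *+ 2) -> p = 0.
  move=> pe; apply/eqP; rewrite -normr_le0; apply/ler_addgt0Pl => e e0.
  by rewrite addr0 (le_trans (pe (e / 2) _)) ?divr_gt0// -mulrnAl -mulr_natl; lra.
split.
  apply: eq0 => e /approx[g [g0 _] fg]; rewrite -[f _]subr0 -g0.
  apply: (le_trans (norm_evalB f g _)); apply: (le_trans fg).
  by rewrite mulr2n lerDl; exact: le_trans fg.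
move=> n t nt; apply/eqP; rewrite -subr_eq0; apply/eqP.
apply: eq0 => e /approx[g [_ gE] fg].
rewrite (_ : _ - _ = (f - g) (unit_point t) - amplitude n (f - g) *: square_curve (zoom n t)).
  rewrite (le_trans (ler_normB _ _))// mulr2n lerD//.
    exact: le_trans (norm_evalB f g _) fg.
  rewrite normrZ (le_trans _ fg)// -[leRHS]mulr1 ler_pM ?norm_square_curve//.
  apply: le_trans (norm_evalB f g (unit_point (unzoom n corner_time))).
  by rewrite norm_pair le_max lexx.
rewrite curve_subE (gE n t nt) (_ : amplitude n (f - g) = amplitude n f - amplitude n g)//.
by rewrite scalerBl opprB addrA subrK.
Qed.

Lemma range_block_space f : block_space f -> f != 0 ->
  0 < `|f| /\ range f = square `|f|.
Proof.
move=> [f0 fE] fn0; have nf0 : 0 < `|f| by rewrite normr_gt0.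
split => //.
have [z fz fle] := curve_norm_attained f.
apply/seteqP; split => [_ [y _ <-]|[x y] [/= xr yr]].
  have := fle y; rewrite norm_pair ge_max => /andP[xr yr].
  by split; rewrite /= in_itv/= -ler_norml.
(* The norm is not attained at 0, where [f] vanishes, hence in some block [n]. The size of that
   block is then the whole norm, and it alone fills the square. *)
have z01 : 0 < set_val z <= 1.
  have /andP[z0 ->] := set_val_itv z; rewrite andbT lt_neqAle z0 andbT.
  apply/eqP => zE; move: nf0.
  by rewrite -fz -(unit_pointK z) -zE f0 normr0 ltxx.
have [n nz] := zoom_cover z01.
have fa : `|f| = `|amplitude n f|.
  apply/eqP; rewrite eq_le -{1}fz -{1}(unit_pointK z) (fE n)// normrZ.
  rewrite ler_piMr ?norm_square_curve//=.
  apply: le_trans (fle (unit_point (unzoom n corner_time))).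
  by rewrite [leRHS]norm_pair le_max lexx.
have a0 : amplitude n f != 0 by rewrite -normr_gt0 -fa.
have [||t [t01 tx ty]] := @square_coord_surj R (x / amplitude n f) (y / amplitude n f).
- by rewrite normrM normfV -fa ler_pdivrMr// mul1r ler_norml; move: xr; rewrite in_itv.
- by rewrite normrM normfV -fa ler_pdivrMr// mul1r ler_norml; move: yr; rewrite in_itv.
exists (unit_point (unzoom n t)) => //.
rewrite (fE n) unzoomK// /square_curve tx ty.
by congr pair; rewrite /= [LHS]mulrC divfK.
Qed.

Lemma block_space_filling : block_space `\ 0 `<=` space_filling_curves R.
Proof.
move=> f [fM /eqP f0]; have [r0 rE] := range_block_space fM f0.
by rewrite /space_filling_curves /= rE; split;
  [exact: jordan_measurable_square|exact: jordan_content_gt0].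
Qed.

(** * Block curves supported on a given set of indices *)

Definition block_coord (b : nat -> bool) (i : bool) t : R :=
  binary_sum (fun n => (b n)%:R * square_coord i (zoom n t)).

Lemma norm_block_term (b : bool) i n t : `|b%:R * square_coord i (zoom n t)| <= 1.
Proof. by case: b; rewrite ?mul0r ?normr0// mul1r norm_square_coord. Qed.

(** The weights in [binary_sum] give uniform convergence, also near 0, where the blocks
    accumulate. *)
Lemma continuous_block_coord b i : continuous (block_coord b i).
Proof.
apply: (@continuous_binary_sum _ R (fun n z => (b n)%:R * square_coord i (zoom n z))).
  move=> n t; apply: cvgMr.
  apply: (@continuous_comp R R R (zoom n)); last exact: continuous_square_coord.
  by apply: cvgD; [apply: cvgMr; exact: cvg_id|exact: cvg_cst].
by move=> n t; exact: norm_block_term.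
Qed.

Lemma continuous_block_path b :
  continuous (fun t => (block_coord b false t, block_coord b true t)).
Proof.
move=> t; apply: (cvg_pair (G := nbhs (block_coord b false t))
  (H := nbhs (block_coord b true t))); exact: continuous_block_coord.
Qed.

Definition block_curve b : curve R := mkcts (continuous_set_val (@continuous_block_path b)).

Lemma block_coord0 b i : block_coord b i 0 = 0.
Proof.
apply: (binary_sum_uniq (x := fun=> 0)) => k; first by rewrite normr0.
by rewrite square_coord_out ?mulr0 ?add0r ?mul0r// /zoom mulr0; lra.
Qed.

(** Only block [n] contributes: as [2 ^+ n.+1 * t] lies in [1, 2], [2 ^+ k.+1 * t] is at most 1 for
    [k < n] and at least 2 for [k > n], where the pasted copy vanishes. *)
Lemma block_coordE b i n t : 0 <= zoom n t <= 1 ->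
  block_coord b i t = (b n)%:R / 2 ^+ n.+1 * square_coord i (zoom n t).
Proof.
move=> nt; have /andP[t0 t1] := zoom_unit nt.
rewrite /block_coord (binary_sum_single (n := n)); first by rewrite mulrAC.
  exact: norm_block_term.
move=> k kn; rewrite square_coord_out ?mulr0// negb_and -!leNgt.
have pow_ge2 m : (0 < m)%N -> 2 <= 2 ^+ m :> R.
  by case: m => // m _; rewrite exprS ler_peMr// exprn_ege1// ler1n.
have powE p q : (p < q)%N -> 2 ^+ q.+1 * t = 2 ^+ (q - p) * (2 ^+ p.+1 * t).
  by move=> /ltnW pq; rewrite mulrA -exprD addnS subnK.
move: nt; rewrite /zoom => /andP[z0 z1].
have [{}kn|nk|kE] := ltngtP k n; last by rewrite kE eqxx in kn.
  apply/orP; left; have nk0 := pow_ge2 (n - k)%N; rewrite subn_gt0 in nk0.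
  rewrite (powE k)// in z1.
  have w0 : 0 < 2 ^+ k.+1 * t by rewrite mulr_gt0// exprn_gt0.
  have := ler_wpM2r (ltW w0) (nk0 kn); lra.
apply/orP; right; have kn0 := pow_ge2 (k - n)%N; rewrite subn_gt0 in kn0.
rewrite (powE n)//.
have w0 : 0 <= 2 ^+ n.+1 * t by rewrite mulr_ge0 ?exprn_ge0 ?(ltW t0).
have := ler_wpM2r w0 (kn0 nk); lra.
Qed.

Lemma amplitude_block_curve b n : amplitude n (block_curve b) = (b n)%:R / 2 ^+ n.+1.
Proof.
have [c01 [cE _]] := corner_timeP.
have u01 : 0 <= zoom n (unzoom n corner_time) <= 1 by rewrite unzoomK.
have /andP[/ltW t0 t1] := zoom_unit u01.
rewrite /amplitude /block_curve /= -[X in block_coord _ _ X]/(set_val (unit_point _)).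
by rewrite val_unit_point ?t0// (block_coordE _ _ u01) unzoomK cE mulr1.
Qed.

Lemma block_curve_mem b : block_space (block_curve b).
Proof.
split.
  rewrite -[LHS]/(block_coord b false (set_val (unit_point 0)),
    block_coord b true (set_val (unit_point 0))).
  by rewrite val_unit_point ?lexx ?ler01// !block_coord0.
move=> n t nt; have /andP[/ltW t0 t1] := zoom_unit nt.
rewrite -[LHS]/(block_coord b false (set_val (unit_point t)),
  block_coord b true (set_val (unit_point t))).
by rewrite val_unit_point ?t0// !(block_coordE _ _ nt) amplitude_block_curve.
Qed.

(** The single-block curves, scaled to amplitude 1, are dual to the amplitudes. *)
Lemma block_space_infinite_dimensional : ~ finite_dimensional block_space.
Proof.
apply: (infinite_dimensional (c := amplitude)
  (f := fun j => 2 ^+ j.+1 *: block_curve (eq_op^~ j))).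
- exact: amplitude_linear.
- move=> j; have := block_space_subspace.2 (2 ^+ j.+1) (block_curve (eq_op^~ j)) 0.
  rewrite addr0 !inE; apply; first exact: block_curve_mem.
  by have := block_space_subspace.1; rewrite inE.
- move=> i j; rewrite -[LHS]/(2 ^+ j.+1 * amplitude i (block_curve (eq_op^~ j))).
  rewrite amplitude_block_curve; have [->|] := eqVneq i j; last by rewrite mul0r mulr0.
  by rewrite mul1r divff// expf_neq0.
Qed.

(** * Continuum many linearly independent block curves *)

(* The codes of the finite prefixes of [x]; distinct sequences share only
   finitely many prefixes. *)
Definition prefix_set (x : nat -> bool) (n : nat) : bool :=
  if @unpickle (seq bool) n is Some l then l == mkseq x (size l) else false.

Lemma prefix_set_code x y k :
  prefix_set y (pickle (mkseq x k)) = (mkseq x k == mkseq y k).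
Proof. by rewrite /prefix_set pickleK size_mkseq. Qed.

Lemma prefix_set_separate x y : x <> y ->
  exists k0, forall k, (k0 <= k)%N -> prefix_set y (pickle (mkseq x k)) = false.
Proof.
move=> xy; have [j xyj] : exists j, x j <> y j.
  by apply/existsNP => xyE; apply: xy; exact/funext.
exists j.+1 => k jk; rewrite prefix_set_code; apply/eqP => xyk.
by apply: xyj; rewrite -(nth_mkseq false x jk) -(nth_mkseq false y jk) xyk.
Qed.

Definition prefix_curve x : curve R := block_curve (prefix_set x).

Lemma amplitude_prefix_curve x y k :
  amplitude (pickle (mkseq x k)) (prefix_curve y) =
  (mkseq x k == mkseq y k)%:R / 2 ^+ (pickle (mkseq x k)).+1.
Proof. by rewrite amplitude_block_curve prefix_set_code. Qed.

Lemma prefix_curve_inj : injective prefix_curve.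
Proof.
move=> x y xyE; apply: contrapT => /prefix_set_separate[k /(_ k (leqnn k))].
rewrite prefix_set_code => xyk.
have := amplitude_prefix_curve x y k; rewrite -xyE amplitude_prefix_curve xyk eqxx.
move=> /(congr1 ( *%R^~ (2 ^+ (pickle (mkseq x k)).+1))).
by rewrite mul0r mul0r divfK ?expf_neq0// => /eqP; rewrite oner_eq0.
Qed.

(** A long enough prefix of [x] separates it from the finitely many other sequences involved; the
    amplitude at its code isolates the coefficient of [prefix_curve x]. *)
Lemma prefix_curve_lin_indep : lin_indep (range prefix_curve).
Proof.
move=> s a us sL s0 g gs; have [x _ xg] := sL _ gs.
have [k0 k0P] : exists k0, forall k, (k0 <= k)%N -> forall y, y \in s -> y != g ->
    amplitude (pickle (mkseq x k)) y = 0.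
  elim: s sL {us s0 gs} => [_|h s IH sL]; first by exists 0%N.
  have [k1 k1P] := IH (fun y ys => sL y (mem_behead (s := h :: s) ys)).
  have [y _ yh] := sL h (mem_head _ _).
  have [xy|/eqP xy] := eqVneq x y.
    exists k1 => k kk z; rewrite in_cons => /orP[/eqP ->|]; last exact: k1P.
    by rewrite -yh -xg xy eqxx.
  have [k2 k2P] := prefix_set_separate xy.
  exists (maxn k1 k2) => k; rewrite geq_max => /andP[kk1 kk2] z.
  rewrite in_cons => /orP[/eqP -> _|]; last exact: k1P.
  by rewrite -yh amplitude_block_curve k2P// mul0r.
have := functional_lin_comb s a (amplitude_linear (pickle (mkseq x k0))).
rewrite s0 (bigD1_seq g)//= big1_seq ?addr0; last first.
  by move=> y /andP[yg ys]; rewrite k0P// mulr0.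
rewrite -xg amplitude_prefix_curve eqxx /amplitude /= => /esym/eqP.
by rewrite mul1r mulf_eq0 invr_eq0 expf_eq0 /= pnatr_eq0 orbF => /eqP.
Qed.

(** * The cardinality of the space of curves *)

Definition rational_cuts f (n : nat) : bool :=
  if @unpickle (rat * rat * bool)%type n is Some (p, q, i) then
    ratr p < (if i then (f (unit_point (ratr q))).1 else (f (unit_point (ratr q))).2)
  else false.

(** The bits are the Dedekind cuts of both coordinates at rational times. They determine the curve
    there, and by continuity everywhere. *)
Lemma rational_cuts_inj : injective rational_cuts.
Proof.
move=> f g fg.
have cutP (u v : R) : (forall p : rat, (ratr p < u) = (ratr p < v)) -> u = v.
  move=> uv; apply/eqP; rewrite eq_le !leNgt; apply/andP; split; apply/negP => /rat_in_itvoo[p].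
    by rewrite in_itv/= => /andP[vp]; rewrite uv ltNge (ltW vp).
  by rewrite in_itv/= => /andP[vp]; rewrite -uv ltNge (ltW vp).
have eq_rat q : f (unit_point (ratr q)) = g (unit_point (ratr q)).
  have e (i : bool) (p : rat) := congr1 (@^~ (pickle (p, q, i))) fg.
  rewrite [LHS]surjective_pairing [RHS]surjective_pairing; congr pair; apply: cutP => p.
    by have := e true p; rewrite /rational_cuts pickleK.
  by have := e false p; rewrite /rational_cuts pickleK.
pose h t : R := `|f (unit_point t) - g (unit_point t)|.
have ch : continuous h.
  move=> t; apply: cvg_norm; apply: cvgB; exact: continuous_curve_path.
apply/continuousEP => z; rewrite -(unit_pointK z); apply/eqP.
rewrite -subr_eq0 -normr_le0 leNgt; apply/negP => h0.
(* If nonempty, the open set of times where the curves differ contains a rational. *)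
have [||x [hx [q _ qx]]] := @dense_rat R (h @^-1` [set y | 0 < y]).
- by exists (set_val z).
- by apply: open_comp; [move=> t _; exact: ch|exact: open_gt].
- by move: hx; rewrite -qx /h /= eq_rat subrr normr0 ltxx.
Qed.

(** Bit sequences mediate: curves inject into them, and they inject into the independent family. *)
Lemma card_curve_le : ([set: curve R] #<= range prefix_curve)%card.
Proof.
have inj : {in [set: curve R] &, injective (prefix_curve \o rational_cuts)}.
  by move=> f g _ _ /= /prefix_curve_inj/rational_cuts_inj.
have := inj_card_eq inj; rewrite card_eq_le => /andP[_ /card_le_trans]; apply.
by apply: subset_card_le => _ [f _ <-]; exists (rational_cuts f).
Qed.

End block_curves.

Theorem theorem4p2 (R : realType) :
  spaceable (space_filling_curves R) /\
  maximal_lineable (space_filling_curves R).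
Proof.
split; exists block_space; split.
- exact: block_space_subspace.
- exact: block_space_closed.
- exact: block_space_infinite_dimensional.
- exact: block_space_filling.
- exact: block_space_subspace.
- apply: (same_dimension_setT (L := range prefix_curve)).
  + exact: block_space_subspace.
  + by move=> _ [x _ <-]; exact: block_curve_mem.
  + exact: prefix_curve_lin_indep.
  + exact: card_curve_le.
- exact: block_space_filling.
Qed.
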